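(* Let $M=(V,\beta)$ be a matroid over $V$, described by its set of bases $\beta$ (viewed as the set system $(V,\beta)$). Then $t_M(y,y)=q_1(M)(y-1)$, i.e., the Tutte polynomial on the diagonal equals $q_1(M)$ with its variable replaced by $y-1$.
   Context: For a proper set system $M=(V,D)$ (i.e. $D$ a nonempty family of subsets of the finite set $V$) and $X\subseteq V$, the pivot is $M*X=(V,\{Z\oplus X:Z\in D\})$ with $\oplus$ symmetric difference, and $d_M(X)=\min\{|X\oplus Z|: Z\in D\}$, $d_M=d_M(\emptyset)$. The polynomial $q_1$ is $q_1(M)(y)=\sum_{X\subseteq V} y^{d_{M*X}}$ (equivalently $\sum_{X\subseteq V}y^{d_M(X)}$). For a matroid with set of bases $\beta$, the nullity of $X\subseteq V$ is $n(X)=\min\{|X\setminus Y|: Y\in\beta\}$, the rank is $r(X)=|X|-n(X)$, and the Tutte polynomial is $t_M(x,y)=\sum_{X\subseteq V}(x-1)^{r(V)-r(X)}(y-1)^{n(X)}$. *)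

(* Defs.v *)
From HB Require Import structures.
From mathcomp Require Import all_boot all_order all_algebra.

Set Implicit Arguments.
Unset Strict Implicit.
Unset Printing Implicit Defensive.

Import GRing.Theory.
Local Open Scope ring_scope.

(* A set system (V, D) is represented by its family D : {set {set V}}, the
   ground set being the whole finite type V.  Symmetric difference is not
   defined for {set _} in the library. *)
Definition symdiff (V : finType) (A B : {set V}) : {set V} :=
  (A :\: B) :|: (B :\: A).

Definition proper_system (V : finType) (D : {set {set V}}) : bool :=
  D != set0.

Definition pivot (V : finType) (D : {set {set V}}) (X : {set V}) :
  {set {set V}} := [set symdiff Z X | Z in D].

(* The minimum over a nonempty D: the default value #|V| bounds every
   #|X + Z|, so it plays a role only when D is empty. *)
Definition dist (V : finType) (D : {set {set V}}) (X : {set V}) : nat :=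
  \big[minn/#|V|]_(Z in D) #|symdiff X Z|.

Definition dist0 (V : finType) (D : {set {set V}}) : nat := dist D set0.

Definition q1 (V : finType) (D : {set {set V}}) : {poly int} :=
  \sum_(X : {set V}) 'X ^+ dist0 (pivot D X).

Definition basis_exchange (V : finType) (B : {set {set V}}) : Prop :=
  forall X Y : {set V}, X \in B -> Y \in B ->
  forall x : V, x \in X :\: Y ->
  exists2 y : V, y \in Y :\: X & y |: (X :\ x) \in B.

Definition is_matroid (V : finType) (B : {set {set V}}) : Prop :=
  proper_system B /\ basis_exchange B.

(* As for dist, the default #|X| is an upper bound of the values. *)
Definition nullity (V : finType) (B : {set {set V}}) (X : {set V}) : nat :=
  \big[minn/#|X|]_(Y in B) #|X :\: Y|.

(* Neither this subtraction (nullity B X <= #|X|) nor the exponent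
   rank B setT - rank B X below is truncated when B is a matroid. *)
Definition rank (V : finType) (B : {set {set V}}) (X : {set V}) : nat :=
  (#|X| - nullity B X)%N.

(* Bivariate polynomials follow polyXY: the outer 'X is the variable x, and
   'Y := 'X%:P is the variable y.  Hence for t : {poly {poly int}} the
   polynomial t(y, y) is t.['X], which substitutes y for the outer variable. *)
Definition tutte (V : finType) (B : {set {set V}}) : {poly {poly int}} :=
  \sum_(X : {set V})
    ('X - 1) ^+ (rank B [set: V] - rank B X) * ('Y - 1) ^+ nullity B X.

Definition diagonal (t : {poly {poly int}}) : {poly int} := t.['X].

(* Main.v *)
Require Import Defs.
From mathcomp Require Import all_boot all_order all_algebra.
From mathcomp Require Import zify.

(** All bases have the same size r, so |X + Z| = |X \ Z| + |Z \ X| equals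
    r - |X| + 2 |X \ Z| for every basis Z.  Hence one and the same basis Z
    attains both d_M(X) and n(X), and then |X \ Z| = n(X) while
    |Z \ X| = r - |X :&: Z| = r(V) - r(X).  The two sums therefore agree term by
    term. *)

Import GRing.Theory.
Local Open Scope ring_scope.

(** Evaluates [nullity] and [dist] at a known minimiser. The default [d] takes part in the minimum,
    hence the bound [F i <= d]. *)
Lemma bigmin_eq_at (I : finType) (A : {set I}) (F : I -> nat) (d : nat)
    (i : I) : i \in A -> (F i <= d)%N ->
  (forall j, j \in A -> (F i <= F j)%N) -> \big[minn/d]_(j in A) F j = F i.
Proof.
move=> iA Fi_d Fi_min; apply/eqP; rewrite eqn_leq; apply/andP; split.
  move: (mem_index_enum i); elim: (index_enum I) => // j s IHs.
  rewrite inE big_cons => /predU1P[<-|/IHs le_s]; first by rewrite iA geq_minl.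
  by case: ifP => // _; rewrite geq_min le_s orbT.
apply: (big_ind (fun m => (F i <= m)%N)) => // m n le_m le_n.
by rewrite leq_min le_m.
Qed.

Lemma symdiff0s (V : finType) (A : {set V}) : symdiff set0 A = A.
Proof. by rewrite /symdiff set0D setD0 set0U. Qed.

Lemma card_symdiff (V : finType) (A C : {set V}) :
  #|symdiff A C| = (#|A :\: C| + #|C :\: A|)%N.
Proof.
rewrite /symdiff cardsU; suff -> : (A :\: C) :&: (C :\: A) = set0.
  by rewrite cards0 subn0.
by apply/setP=> x; rewrite !inE; case: (x \in A); case: (x \in C).
Qed.

Section Matroid.

Variables (V : finType) (B : {set {set V}}).
Hypothesis exB : basis_exchange B.

(* Induction on #|X :\: Y|: an exchange step moves X one element closer to Y
   without changing its size. *)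
Lemma leq_card_bases (X Y : {set V}) : X \in B -> Y \in B -> (#|X| <= #|Y|)%N.
Proof.
have [n] := ubnP #|X :\: Y|; elim: n X => // n IHn X le_n XB YB.
have [/eqP|[x xXY]] := set_0Vmem (X :\: Y).
  by rewrite setD_eq0 => /subset_leq_card.
have [y yYX X'B] := exB _ _ XB YB _ xXY.
have [/setDP[xX xY] /setDP[yY yX]] := (xXY, yYX).
have cardX' : #|y |: (X :\ x)| = #|X|.
  by rewrite cardsU1 !inE (negPf yX) andbF (cardsD1 x X) xX.
rewrite -cardX'; apply: IHn => //.
have -> : (y |: (X :\ x)) :\: Y = (X :\: Y) :\ x.
  apply/setP=> z; rewrite !inE; case: (eqVneq z y) => [->|_] /=.
    by rewrite yY andbF.
  by rewrite andbCA.
by move: le_n; rewrite (cardsD1 x (X :\: Y)) xXY.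
Qed.

Lemma card_bases (X Y : {set V}) : X \in B -> Y \in B -> #|X| = #|Y|.
Proof. by move=> XB YB; apply/eqP; rewrite eqn_leq !leq_card_bases. Qed.

(** Bases are equicardinal, so the minimum runs over a constant family and any basis attains it. *)
Lemma nullity_setT (Y : {set V}) : Y \in B -> nullity B setT = (#|V| - #|Y|)%N.
Proof.
move=> YB; have cardTD Z : #|[set: V] :\: Z| = (#|V| - #|Z|)%N.
  by rewrite setTD cardsCs setCK.
rewrite /nullity (bigmin_eq_at _ _ _ _ Y) ?cardTD // ?cardsT ?leq_subr //.
by move=> Z ZB; rewrite cardTD (card_bases _ _ ZB YB).
Qed.

Lemma dist0_pivot (X : {set V}) : proper_system B ->
  dist0 (pivot B X) = (rank B setT - rank B X + nullity B X)%N.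
Proof.
case/set0Pn=> Y0 Y0B.
case: (@arg_minnP _ Y0 (mem B) (fun Y : {set V} => #|X :\: Y|) Y0B) => Y YB minY.
have cID (A C : {set V}) := cardsID C A.
have nullX : nullity B X = #|X :\: Y|.
  by apply: bigmin_eq_at => //; rewrite subset_leq_card ?subsetDl.
have distX : dist0 (pivot B X) = #|symdiff Y X|.
  rewrite /dist0 /dist (bigmin_eq_at _ _ _ _ (symdiff Y X)) ?symdiff0s //.
  - exact: imset_f.
  - exact: max_card.
  move=> _ /imsetP[Z ZB ->]; rewrite symdiff0s !card_symdiff.
  (* Splitting each set along its intersection with [X] or a basis reduces the comparison of
     distances to that of [#|X :\: Y|] and [#|X :\: Z|]. *)
  have := minY Z ZB; have := card_bases _ _ ZB YB.
  have := cID X Y; have := cID X Z; have := cID Y X; have := cID Z X.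
  rewrite (setIC Y X) (setIC Z X); lia.
rewrite distX card_symdiff /rank nullX (nullity_setT _ YB) cardsT.
(* The bound on [#|Y|] collapses the truncated [#|V| - (#|V| - #|Y|)] to [#|Y|]; the rank of [X]
   becomes [#|X :&: Y|]. *)
have := cID X Y; have := cID Y X; have : (#|Y| <= #|V|)%N by exact: max_card.
rewrite (setIC Y X); lia.
Qed.

End Matroid.

Theorem theorem12 (V : finType) (B : {set {set V}}) (hB : is_matroid B) :
  diagonal (tutte B) = q1 B \Po ('X - 1).
Proof.
case: hB => B0 exB; rewrite /diagonal /tutte /q1 horner_sum raddf_sum /=.
apply: eq_bigr => X _; rewrite dist0_pivot // exprD.
(* Evaluation at ['X] fixes the constant ['Y], which is the inner ['X], so both factors become
   powers of ['X - 1]. *)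
rewrite hornerM !horner_exp !hornerE rmorphM !rmorphXn /=.
by rewrite comp_polyX.
Qed.
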